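(* Consider the following family of instances of online bipartite matching with homogeneous groups, indexed by an integer $n\ge2$: the online types are $J=\{0,1,\dots,n\}$ with arrival rates $\lambda_t=1/n$ for $t=1,\dots,n$ and $\lambda_0=n-1$; the offline agents are $I=\{1,\dots,n\}$, each with capacity $1$; offline agent $t$ is eligible to serve exactly online types $t$ and $0$. Under the long-run fairness objective, any online algorithm (possibly rejecting, randomized and adaptive) is no more than $(\sqrt3-1)$-competitive relative to the best clairvoyant algorithm on this family; that is, there is no constant $c>\sqrt3-1$ such that for every $n$ the online algorithm's long-run fairness is at least $c$ times that of the optimal clairvoyant algorithm.
   Context: Model: offline agents $I$ with integer capacities, online types $J$, eligibility edges $E\subseteq I\times J$. Online agents of type $j$ arrive by independent Poisson processes of constant rate $\lambda_j>0$ on $[0,1]$; on each arrival its type is revealed and an online algorithm (which knows all parameters in advance and may be randomized) must immediately and irrevocably serve it with an eligible offline agent with remaining capacity, or reject it. A clairvoyant algorithm knows the realized arrivals in advance and assigns (possibly randomly) subject to the same eligibility and capacity constraints. Homogeneous groups: each type forms its own protected group; the long-run fairness of an algorithm is $\min_{j\in J}\mathbb E[X_j]/\lambda_j$ with $X_j$ the number of type-$j$ agents served (expectation over arrivals and randomness). An algorithm is $c$-competitive on a class of instances if its objective is at least $c$ times the optimal clairvoyant objective on every instance in the class. *)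

(* Defs.v *)
From HB Require Import structures.
From mathcomp Require Import all_boot all_order all_algebra.
From mathcomp Require Import all_classical all_reals all_analysis.

Set Implicit Arguments.
Unset Strict Implicit.
Unset Printing Implicit Defensive.

Import Order.TTheory GRing.Theory Num.Theory.
Import numFieldNormedType.Exports.

Local Open Scope classical_set_scope.
Local Open Scope ring_scope.

Record instance (R : realType) := Instance {
  offline : finType;
  otype : finType;
  capacity : offline -> nat;
  eligible : offline -> otype -> bool;
  rate : otype -> R;
  rate_gt0 : forall j, 0 < rate j
}.

(* The events {N r = m} with r in [0, s]; they generate the information
   carried by the process N up to time s. *)
Definition history_gen (R : realType) (T : Type) (N : R -> T -> nat) (s : R) :
    set (set T) :=
  [set A | exists r m, 0 <= r <= s /\ A = [set w | N r w = m]].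

(* N r w is the number of arrivals in [0, r]. *)
Record is_poisson_process (R : realType) (d : measure_display)
    (T : measurableType d) (P : probability T R) (lambda : R)
    (N : R -> T -> nat) : Prop := IsPoissonProcess {
  poisson_measurable : forall t, 0 <= t <= 1 -> measurable_fun setT (N t);
  poisson_start : forall w, N 0 w = 0%N;
  poisson_mono : forall w s t, 0 <= s -> s <= t -> t <= 1 ->
    (N s w <= N t w)%N;
  poisson_right_continuous : forall w t, 0 <= t < 1 ->
    \forall s \near t^'+, N s w = N t w;
  poisson_law : forall s t m, 0 <= s -> s < t -> t <= 1 ->
    P [set w | (N t w - N s w)%N = m] =
      (poisson_pmf (lambda * (t - s)) m)%:E;
  poisson_indep_increments : forall s t m A, 0 <= s -> s < t -> t <= 1 ->
    <<s history_gen N s >> A ->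
    P (A `&` [set w | (N t w - N s w)%N = m]) =
      (P A * P [set w | (N t w - N s w)%N = m])%E
}.

(* A probability space carrying the arrivals of an instance on [0, 1] and the
   internal randomness (seed) available to online algorithms. *)
Record setting (R : realType) (X : instance R) := Setting {
  odisp : measure_display;
  Omega : measurableType odisp;
  Pr : probability Omega R;
  arrivals : otype X -> R -> Omega -> nat;
  sdisp : measure_display;
  Seed : measurableType sdisp;
  seed : Omega -> Seed;
  arrivals_poisson : forall j, is_poisson_process Pr (rate j) (arrivals j);
  seed_measurable : measurable_fun setT seed;
  (* As the A j and B may be setT, this is the mutual independence of all the
     arrival processes and the seed. *)
  arrivals_seed_indep : forall (A : otype X -> set Omega) (B : set Seed),
    (forall j, <<s history_gen (arrivals j) 1 >> (A j)) -> measurable B ->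
    Pr (seed @^-1` B `&` \bigcap_j A j) =
      (Pr (seed @^-1` B) * \prod_j Pr (A j))%E
}.

(* D j k w is the decision taken for the (k+1)-st arriving agent of type j:
   the offline agent serving it, or None for a rejection.  It is meaningful
   only when there is such an arrival, i.e., when k < arrivals j 1 w. *)
Definition decisions (R : realType) (X : instance R) (S : setting X) :=
  otype X -> nat -> Omega S -> option (offline X).

(* The number of agents of type j served. *)
Definition served (R : realType) (X : instance R) (S : setting X)
    (D : decisions S) (j : otype X) (w : Omega S) : nat :=
  (\sum_(k < arrivals j 1 w) (D j k w != None))%N.

(* The number of online agents served by the offline agent i. *)
Definition load (R : realType) (X : instance R) (S : setting X)
    (D : decisions S) (i : offline X) (w : Omega S) : nat :=
  (\sum_(j : otype X) \sum_(k < arrivals j 1 w) (D j k w == Some i))%N.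

(* Since decisions may depend on the whole outcome w, these are exactly the
   (randomized) clairvoyant algorithms. *)
Record clairvoyant (R : realType) (X : instance R) (S : setting X)
    (D : decisions S) : Prop := Clairvoyant {
  decisions_measurable : forall j k o,
    measurable [set w | (k < arrivals j 1 w)%N /\ D j k w = o];
  decisions_eligible : forall w j k i,
    (k < arrivals j 1 w)%N -> D j k w = Some i -> eligible i j;
  decisions_capacity : forall w i, (load D i w <= capacity i)%N
}.

(* Generators of the information available to an online algorithm at time s:
   the seed and the arrivals of all types up to time s. *)
Definition information_gen (R : realType) (X : instance R) (S : setting X)
    (s : R) : set (set (Omega S)) :=
  [set A | exists2 B, measurable B & A = @seed _ _ S @^-1` B] `|`
  \bigcup_j history_gen (@arrivals _ _ S j) s.
Arguments information_gen {R X} S s.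

(* The (k+1)-st agent of type j has arrived by time s iff k < arrivals j s w,
   so the last condition says that D j k is measurable with respect to the
   information available at the (random) arrival time of that agent.  A unit
   of capacity is never released, so the capacity bound at time 1 contained in
   clairvoyant enforces the remaining capacities at all times. *)
Definition online (R : realType) (X : instance R) (S : setting X)
    (D : decisions S) : Prop :=
  clairvoyant D /\
  forall s j k o, 0 <= s <= 1 ->
    <<s information_gen S s >>
      [set w | (k < arrivals j s w)%N /\ D j k w = o].

Definition fairness (R : realType) (X : instance R) (S : setting X)
    (D : decisions S) : \bar R :=
  (\big[Order.min/+oo]_(j : otype X)
     ('E_(Pr S)[fun w => (served D j w)%:R] / (rate j)%:E))%E.

Definition clairvoyant_opt (R : realType) (X : instance R) : \bar R :=
  ereal_sup [set v | exists (S : setting X) (D : decisions S),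
                       clairvoyant D /\ v = fairness D].

Definition hard_rate (R : realType) (n : nat) (j : 'I_n.+1) : R :=
  if j == ord0 then n%:R - 1 else n%:R^-1.

Lemma hard_rate_gt0 (R : realType) (n : nat) (hn : (2 <= n)%N) (j : 'I_n.+1) :
  0 < hard_rate R j.
Proof.
rewrite /hard_rate; case: ifP => _.
  by rewrite subr_gt0 ltr1n.
by rewrite invr_gt0 ltr0n (leq_trans _ hn).
Qed.

(* The online types are 0, ..., n; the offline agents 1, ..., n are encoded
   as i : 'I_n standing for agent i + 1. *)
Definition hard_instance (R : realType) (n : nat) (hn : (2 <= n)%N) :
    instance R :=
  @Instance R 'I_n 'I_n.+1 (fun _ => 1%N)
    (fun i j => (j == i.+1 :> nat) || (j == 0%N :> nat))
    (@hard_rate R n) (@hard_rate_gt0 R n hn).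

(* Main.v *)
(* An online algorithm that serves type 0 at least v (n - 1) times on average
   must have served it (v - 1 + s) (n - 1) times by time s, because only about
   (1 - s) (n - 1) agents of type 0 arrive afterwards. A type t >= 1 can be served
   only while agent t has not been given to type 0, and its arrival after s is
   independent of the information at s. Averaging over t and integrating over s
   gives v <= 1 - v^2 / 2 + o(1), that is, v <= sqrt 3 - 1 + o(1). Conversely the
   clairvoyant who first serves the types t >= 1 and gives the remaining agents to
   type 0 loses only o(1). That strategy is run on the probability space provided
   with the online algorithm, so no Poisson process has to be constructed. *)
Require Import Defs.
From mathcomp Require Import all_boot all_order all_algebra.
From mathcomp Require Import all_classical all_reals all_analysis.
From mathcomp Require Import measurable_realfun ring lra.

Set Implicit Arguments.
Unset Strict Implicit.
Unset Printing Implicit Defensive.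

Import Order.TTheory GRing.Theory Num.Theory.
Import numFieldNormedType.Exports.
Local Open Scope classical_set_scope.
Local Open Scope ring_scope.

(** * Moments of the Poisson distribution *)

Section poisson_sums.
Variables (R : realType) (l : R).
Hypothesis l0 : 0 < l.
Local Open Scope ereal_scope.

Lemma sum_poisson_pmf : \sum_(m <oo) (poisson_pmf l m)%:E = 1.
Proof.
have := @probability_setT _ _ R (poisson_prob l 0%N).
rewrite /= /poisson_prob l0 => <-.
by rewrite -nneseries_esumT// => n; rewrite lee_fin poisson_pmf_ge0.
Qed.

Lemma poisson_pmfS (m : nat) :
  (m.+1%:R * poisson_pmf l m.+1 = l * poisson_pmf l m)%R.
Proof.
rewrite /poisson_pmf l0 factS natrM exprS.
by field; rewrite nat1r !pnatr_eq0 -lt0n fact_gt0.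
Qed.

(** This is the Chen-Stein identity E[Z f(Z - 1)] = l E[f(Z)]. The factor [m] kills the term at 0,
    where [m.-1] is a junk value, and the recursion [poisson_pmfS] shifts the rest by one. Taking f
    = 1 and f(m) = m yields the first two factorial moments. *)
Lemma poisson_stein (f : nat -> R) : (forall m, 0 <= f m)%R ->
  \sum_(m <oo) ((m%:R * f m.-1) * poisson_pmf l m)%:E =
  l%:E * \sum_(m <oo) (f m * poisson_pmf l m)%:E.
Proof.
move=> f0; have p0 := poisson_pmf_ge0 l.
rewrite nneseries_recl//; last by move=> m _; rewrite lee_fin !mulr_ge0.
rewrite !mul0r add0e -nneseries_addn; last first.
  by move=> m; rewrite lee_fin !mulr_ge0.
rewrite -nneseriesZl; last by move=> m _; rewrite lee_fin mulr_ge0.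
apply: eq_eseriesr => m _; rewrite addn1/= -EFinM; congr EFin.
by rewrite mulrAC poisson_pmfS; ring.
Qed.

Lemma poisson_mean : \sum_(m <oo) (m%:R * poisson_pmf l m)%:E = l%:E.
Proof.
have := @poisson_stein (fun=> 1%R) (fun=> ler01).
under eq_eseriesr do rewrite mulr1.
under [in X in _ = _ * X -> _]eq_eseriesr do rewrite mul1r.
by rewrite sum_poisson_pmf mule1.
Qed.

Lemma poisson_factorial_moment2 :
  \sum_(m <oo) ((m%:R * m.-1%:R) * poisson_pmf l m)%:E = (l ^+ 2)%:E.
Proof.
by rewrite (poisson_stein (fun m => ler0n _ m)) poisson_mean -EFinM expr2.
Qed.

End poisson_sums.

(** * Expectations of functions of an integer-valued random variable *)

Section integral_nat.
Local Open Scope ereal_scope.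
Variables (R : realType) (d : measure_display) (T : measurableType d).
Variables (mu : {measure set T -> \bar R}) (Z : T -> nat).
Hypothesis mZ : measurable_fun setT Z.

Lemma measurable_nat_eq m : measurable [set w | Z w = m].
Proof. by have := mZ measurableT (Y := [set m]) I; rewrite setTI. Qed.

(** The integrand is the series of the f(m) times the indicator of {Z = m}. Its terms are
    nonnegative, so sum and integral may be exchanged. *)
Lemma integral_nat (f : nat -> R) : (forall m, 0 <= f m)%R ->
  \int[mu]_w (f (Z w))%:E = \sum_(m <oo) (f m)%:E * mu [set w | Z w = m].
Proof.
move=> f0.
have mI m : measurable_fun setT (fun w => (\1_[set w | Z w = m] w)%:E : \bar R).
  by apply/measurable_EFinP; apply: measurable_indic; exact: measurable_nat_eq.
transitivity (\int[mu]_w \sum_(m <oo) (f m)%:E * (\1_[set w | Z w = m] w : R)%:E).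
  apply: eq_integral => w _.
  rewrite (@nneseriesD1 _ _ (Z w))//=; last first.
    by move=> k _; rewrite mule_ge0// lee_fin.
  rewrite indicE mem_set//= mule1 eseries0 ?adde0// => k _ kZ.
  by rewrite indicE memNset ?mule0//= => Zk; move: kZ; rewrite Zk eqxx.
rewrite integral_nneseries//; last 2 first.
- by move=> m; exact: measurable_funeM.
- by move=> m w _; rewrite mule_ge0// lee_fin.
apply: eq_eseriesr => m _; rewrite ge0_integralZl_EFin// ?integral_indic ?setIT//.
exact: measurable_nat_eq.
Qed.

Lemma integral_poisson (l : R) (f : nat -> R) : (forall m, 0 <= f m)%R ->
  (forall m, mu [set w | Z w = m] = (poisson_pmf l m)%:E) ->
  \int[mu]_w (f (Z w))%:E = \sum_(m <oo) (f m * poisson_pmf l m)%:E.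
Proof.
move=> f0 law; rewrite integral_nat//.
by apply: eq_eseriesr => m _; rewrite law EFinM.
Qed.

End integral_nat.

Lemma measurable_fun_nat (d : measure_display) (T : measurableType d)
    (Z : T -> nat) :
  (forall m, measurable [set w | Z w = m]) -> measurable_fun setT Z.
Proof.
move=> mZ _ Y _; rewrite setTI.
rewrite (_ : _ @^-1` _ = \bigcup_(m in Y) [set w | Z w = m]); last first.
  by apply/seteqP; split => [w Yw|w [m Ym /= zm]]; [exists (Z w)|rewrite zm].
by apply: bigcup_measurable => m _; exact: mZ.
Qed.

(** * Independence of future increments from the information at a given time *)

Section setting.
Variables (R : realType) (X : instance R) (S : setting X).
Implicit Types (s t : R) (j : otype X) (A : set (Omega S)).

Let poisson j := @arrivals_poisson R X S j.

Lemma measurable_arrivals j t : 0 <= t <= 1 ->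
  measurable_fun setT (@arrivals _ _ S j t).
Proof. exact: (poisson_measurable (poisson j)). Qed.

Lemma history_measurable_arrivals j (s t : R) : 0 <= s <= t ->
  @measurable_fun _ _ (g_sigma_algebraType (history_gen (@arrivals _ _ S j) t))
    nat setT (@arrivals _ _ S j s).
Proof.
move=> st; apply: measurable_fun_nat => m.
by apply: sub_sigma_algebra; exists s, m.
Qed.

Lemma history_increment j (s t : R) m : 0 <= s -> s <= t -> t <= 1 ->
  <<s history_gen (@arrivals _ _ S j) 1 >>
    [set w | (arrivals j t w - arrivals j s w)%N = m].
Proof.
move=> s0 st t1.
have := @measurable_fun_subn _
  (g_sigma_algebraType (history_gen (@arrivals _ _ S j) 1)) setT _ _
  (@history_measurable_arrivals j t 1 _) (@history_measurable_arrivals j s 1 _).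
rewrite s0 t1 (le_trans s0 st) (le_trans st t1).
move=> /(_ isT isT measurableT [set m] I).
by rewrite setTI.
Qed.

Lemma history_le j (s t : R) : s <= t ->
  <<s history_gen (@arrivals _ _ S j) s >> `<=`
  <<s history_gen (@arrivals _ _ S j) t >>.
Proof.
move=> st; apply: sub_sigma_algebra2 => _ [r [m [/andP[r0 rs] ->]]].
by exists r, m; rewrite r0 (le_trans rs).
Qed.

Lemma history_measurable j s A : s <= 1 ->
  <<s history_gen (@arrivals _ _ S j) s >> A -> measurable A.
Proof.
move=> s1; apply: smallest_sub; first exact: sigma_algebra_measurable.
move=> _ [r [m [/andP[r0 rs] ->]]].
apply: measurable_nat_eq; apply: measurable_arrivals.
by rewrite r0 (le_trans rs).
Qed.

(* Dynkin's theorem for the intersections of a seed event with one event of the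
   history of each process. *)
Lemma information_increment_indep j s t m A : 0 <= s -> s < t -> t <= 1 ->
  <<s information_gen S s >> A ->
  measurable A /\
  Pr S (A `&` [set w | (arrivals j t w - arrivals j s w)%N = m]) =
    (Pr S A * Pr S [set w | (arrivals j t w - arrivals j s w)%N = m])%E.
Proof.
move=> s0 st t1; set B := [set w | _].
have s1 : s <= 1 by rewrite (le_trans (ltW st)).
have HB : <<s history_gen (@arrivals _ _ S j) 1 >> B.
  by apply: history_increment => //; exact: ltW.
have mB : measurable B by apply: history_measurable HB.
pose G := [set E | exists (C : set (Seed S)) (F : otype X -> set (Omega S)),
  [/\ measurable C, forall i, <<s history_gen (@arrivals _ _ S i) s >> (F i)
    & E = @seed _ _ S @^-1` C `&` \bigcap_i F i]].
have sigT i : <<s history_gen (@arrivals _ _ S i) s >> setT.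
  exact: (@measurableT _ (g_sigma_algebraType (history_gen (@arrivals _ _ S i) s))).
have sGI : setI_closed G.
  move=> _ _ [C [F [mC mF ->]]] [C' [F' [mC' mF' ->]]].
  exists (C `&` C'), (fun i => F i `&` F' i); split; first exact: measurableI.
    move=> i.
    exact: (@measurableI _
      (g_sigma_algebraType (history_gen (@arrivals _ _ S i) s)) _ _ (mF i) (mF' i)).
  by rewrite bigcapI preimage_setI setIACA.
have iG : information_gen S s `<=` G.
  move=> E [[C mC ->]|[i _ iE]].
    exists C, (fun=> setT); split => //.
    by apply/seteqP; split => [w Cw|w []].
  exists setT, (fun k => if k == i then E else setT); split => //.
    by move=> k; case: eqP => // ->; exact: sub_sigma_algebra.
  rewrite preimage_setT setTI; apply/seteqP; split => [w Ew k _|w /(_ i I)].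
    by case: ifP.
  by rewrite eqxx.
have GA : G `<=` [set A | measurable A /\ Pr S (A `&` B) = (Pr S A * Pr S B)%E].
  move=> _ [C [F [mC mF ->]]]; split.
    apply: measurableI.
      by rewrite -[X in measurable X]setTI; exact: seed_measurable.
    apply: fin_bigcap_measurable => [|i _]; first exact: finite_finset.
    exact: history_measurable (mF i).
  have mF1 i : <<s history_gen (@arrivals _ _ S i) 1 >> (F i).
    exact: history_le (mF i).
  (* The increment event is absorbed into the [j]-th component, which then lies in the history up to
     time 1. Mutual independence applies to both families, and independent increments split off the
     factor of [B]. *)
  pose F' i := if i == j then F i `&` B else F i.
  have -> : @seed _ _ S @^-1` C `&` \bigcap_i F i `&` B =
            @seed _ _ S @^-1` C `&` \bigcap_i F' i.
    rewrite -setIA; congr (_ `&` _); apply/seteqP; split => [w [Fw Bw] i _|w F'w].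
      by rewrite /F'; case: ifP => _ //; [split => //|]; exact: Fw.
    split => [i _|]; have := F'w.
      by move=> /(_ i I); rewrite /F'; case: ifP => // _ [].
    by move=> /(_ j I); rewrite /F' eqxx => -[].
  rewrite !arrivals_seed_indep//; last first.
    move=> i; rewrite /F'; case: eqP => [->|_//].
    exact: (@measurableI _
      (g_sigma_algebraType (history_gen (@arrivals _ _ S j) 1)) _ _ (mF1 j) HB).
  rewrite (bigD1 j)//= [in RHS](bigD1 j)//= /F' eqxx.
  rewrite (poisson_indep_increments (poisson j)) -/B//.
  rewrite -!muleA; congr (_ * (_ * _))%E; rewrite muleC; congr (_ * _)%E.
  by apply: eq_bigr => i /negbTE ->.
move=> /(sub_sigma_algebra2 iG).
apply: (@dynkin_induction _ (g_sigma_algebraType G) G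
  [set A | measurable A /\ Pr S (A `&` B) = (Pr S A * Pr S B)%E]) => //.
- by split => //; rewrite setTI probability_setT mul1e.
- move=> E _; move: (E : set (Omega S)) => {}E [mE].
  move=> PE; split; first exact: measurableC.
  change (Pr S (~` E `&` B) = (Pr S (~` E) * Pr S B)%E).
  transitivity (Pr S B - Pr S (E `&` B))%E.
    rewrite setIC -setDE measureD ?(setIC B)//.
    by rewrite ltey_eq fin_num_measure.
  rewrite PE probability_setC// muleBl ?mul1e//.
    by rewrite fin_num_measure.
- move=> F _; move: (F : nat -> set (Omega S)) => {}F tF mF.
  have mF1 n : measurable (F n) by have [] := mF n.
  split; first exact: bigcupT_measurable.
  rewrite setI_bigcupl !measure_bigcup//=; last 2 first.
  + by move=> n _; exact: measurableI.
  + exact: trivIset_setIr.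
  rewrite muleC -[Pr S B]fineK ?fin_num_measure// -nneseriesZl//.
  by apply: eq_eseriesr => n _; rewrite muleC fineK ?fin_num_measure//; have [] := mF n.
Qed.

End setting.

(** The identity (m - l)^2 + 2 l m = m (m - 1) + m + l^2 reduces the variance to the mean, the
    second factorial moment and the total mass. *)
Lemma poisson_variance (R : realType) (l : R) : 0 < l ->
  (\sum_(m <oo) ((m%:R - l) ^+ 2 * poisson_pmf l m)%:E = l%:E)%E.
Proof.
move=> l0; have p0 := poisson_pmf_ge0 l.
(* The cross term is moved to the other side, as 2 l times the mean, so that only series with
   nonnegative terms are added. *)
set V := LHS; suff : (V + (2 * l * l)%:E = l%:E + (2 * l * l)%:E)%E.
  by move=> VE; rewrite -[V](@addeK _ (2 * l * l)%:E)// VE addeK.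
rewrite {}/V [in LHS]EFinM -[X in (_ * X)%E](poisson_mean l0) -nneseriesZl; last first.
  by move=> m _; rewrite lee_fin mulr_ge0.
rewrite -nneseriesD; last 2 first.
- by move=> m _ _; rewrite lee_fin mulr_ge0// sqr_ge0.
- by move=> m _ _; rewrite lee_fin !mulr_ge0// ltW.
transitivity (\sum_(m <oo) (((m%:R * m.-1%:R) * poisson_pmf l m)%:E +
  ((m%:R * poisson_pmf l m)%:E + (l ^+ 2)%:E * (poisson_pmf l m)%:E)))%E.
  apply: eq_eseriesr => m _; rewrite -!EFinM -!EFinD; congr EFin.
  by case: m => [|m]/=; rewrite -?natr1; ring.
rewrite !nneseriesD ?nneseriesZl//; last 5 first.
- by move=> m _; rewrite lee_fin.
- by move=> m _ _; rewrite lee_fin mulr_ge0.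
- by move=> m _ _; rewrite lee_fin mulr_ge0// sqr_ge0.
- by move=> m _ _; rewrite lee_fin !mulr_ge0.
- by move=> m _ _; rewrite -EFinM -EFinD lee_fin addr_ge0// mulr_ge0// sqr_ge0.
rewrite poisson_factorial_moment2// poisson_mean// sum_poisson_pmf// mule1.
by rewrite -!EFinD; congr EFin; ring.
Qed.

(** * Measurability of integer-valued counts *)

Section measurable_nat.
Variables (d : measure_display) (T : measurableType d).

Lemma measurable_nat_pred (Z : T -> nat) (Y : set nat) :
  measurable_fun setT Z -> measurable [set w | Y (Z w)].
Proof. by move=> mZ; have := mZ measurableT Y I; rewrite setTI. Qed.

Lemma measurable_fun_nat_of_bool (b : T -> bool) :
  measurable [set w | b w] -> measurable_fun setT (fun w => nat_of_bool (b w)).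
Proof.
move=> mb; apply: measurable_fun_nat => -[|[|m]].
- rewrite (_ : [set w | _] = ~` [set w | b w]); first exact: measurableC.
  by apply/seteqP; split => w /=; case: (b w).
- rewrite (_ : [set w | _] = [set w | b w]) //.
  by apply/seteqP; split => w /=; case: (b w).
- rewrite (_ : [set w | _] = set0) //.
  by apply/seteqP; split => w //=; case: (b w).
Qed.

Lemma measurable_fun_sumn (I : Type) (r : seq I) (F : I -> T -> nat) :
  (forall i, measurable_fun setT (F i)) ->
  measurable_fun setT (fun w => \sum_(i <- r) F i w)%N.
Proof.
move=> mF; elim: r => [|i r ih].
  by under eq_fun do rewrite big_nil; exact: measurable_cst.
by under eq_fun do rewrite big_cons; exact: measurable_fun_addn.
Qed.

(** Measurability of [b k] is assumed only jointly with [k < N w], since a decision has a meaning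
    only for an agent that arrives. On each slice {N = K} the sum agrees with the sum [s K], which
    has a fixed number of terms. *)
Lemma measurable_fun_random_sum (N : T -> nat) (b : nat -> T -> bool) :
  measurable_fun setT N ->
  (forall k, measurable [set w | (k < N w)%N /\ b k w]) ->
  measurable_fun setT (fun w => \sum_(k < N w) b k w)%N.
Proof.
move=> mN mb.
pose s K w := (\sum_(k < K) ((k < N w)%N && b k w))%N.
have ms K : measurable_fun setT (s K).
  apply: measurable_fun_sumn => k; apply: measurable_fun_nat_of_bool.
  rewrite (_ : [set w | _] = [set w | (k < N w)%N /\ b k w])//.
  by apply/seteqP; split => w /= /andP.
apply: measurable_fun_nat => m.
rewrite (_ : [set w | _] =
    \bigcup_K ([set w | N w = K] `&` [set w | s K w = m])); last first.
  have sE w : (\sum_(k < N w) b k w)%N = s (N w) w.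
    by apply: eq_bigr => k _; rewrite ltn_ord.
  apply/seteqP; split => [w /=|w [K _ [/= NK]]].
    by rewrite sE => sm; exists (N w).
  by rewrite sE NK.
apply: bigcupT_measurable => K.
by apply: measurableI; exact: measurable_nat_eq.
Qed.

Lemma measurable_natr (R : realType) (Z : T -> nat) (f : nat -> R) :
  measurable_fun setT Z -> measurable_fun setT (fun w => (f (Z w))%:E).
Proof.
move=> mZ; apply/measurable_EFinP => _ Y _; rewrite setTI.
exact: (@measurable_nat_pred Z (f @^-1` Y) mZ).
Qed.

End measurable_nat.

Section clairvoyant_measurable.
Variables (R : realType) (X : instance R) (S : setting X) (D : decisions S).
Hypothesis clD : clairvoyant D.

Lemma measurable_served j : measurable_fun setT (served D j).
Proof.
have mN : measurable_fun setT (@arrivals _ _ S j 1).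
  by apply: measurable_arrivals; rewrite ler01 lexx.
apply: (@measurable_fun_random_sum _ _ _ (fun k w => D j k w != None)) => // k.
rewrite (_ : [set w | _] = [set w | (k < arrivals j 1 w)%N] `\`
   [set w | (k < arrivals j 1 w)%N /\ D j k w = None]).
  apply: measurableD; last exact: (decisions_measurable clD).
  exact: (@measurable_nat_pred _ _ _ [set m | (k < m)%N] mN).
apply/seteqP; split => w /=.
  by move=> [kN] /eqP DN; split => // -[].
by move=> [kN h]; split => //; apply/eqP => DN; apply: h.
Qed.

End clairvoyant_measurable.

(** * The clairvoyant greedy algorithm *)

Lemma sum_onth_eq (T : eqType) (s : seq T) (x : T) (K : nat) :
  (\sum_(k < K) (onth s k == Some x) <= count_mem x s)%N.
Proof.
elim: s K => [|y s ih] [|K]; rewrite ?big_ord0// ?big_ord_recl/=.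
  by rewrite big1// => k _; rewrite /onth; case: (k : nat).
apply: leq_add (ih K).
by rewrite (inj_eq Some_inj).
Qed.

Lemma sum_onth_neq_None (T : eqType) (s : seq T) (K : nat) :
  (\sum_(k < K) (onth s k != None) = minn K (size s))%N.
Proof.
elim: s K => [|y s ih] [|K]; rewrite ?big_ord0 ?min0n// ?big_ord_recl/=.
  by rewrite big1// => k _; rewrite /onth; case: (k : nat).
by rewrite minnSS -add1n -ih.
Qed.

Section greedy.
Variables (R : realType) (n : nat) (hn : (2 <= n)%N).
Variable S : setting (hard_instance R hn).
Local Notation N j := (@arrivals _ _ S j 1).
Local Notation own := (lift ord0).

Definition busy (w : Omega S) : {set 'I_n} :=
  [set i | (0 < N (own i) w)%N]%SET.

(** Looking ahead to time 1, the algorithm reserves an agent for the first arrival of its own type,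
    if there is one. The remaining agents go to type 0 in the order of their enumeration, and [onth]
    rejects once the list is exhausted. *)
Definition greedy : decisions S := fun j k w =>
  if unlift ord0 j is Some i then if k == 0%N then Some i else None
  else onth (enum (~: busy w)) k.

Let mN j : measurable_fun setT (N j).
Proof. by apply: measurable_arrivals; rewrite ler01 lexx. Qed.

Lemma served_greedy_own i w :
  served greedy (own i) w = (0 < N (own i) w)%N.
Proof.
rewrite /served /greedy liftK; case: (N (own i) w) => [|m].
  by rewrite big_ord0.
by rewrite big_ord_recl/= big1.
Qed.

Lemma served_greedy0 w :
  served greedy ord0 w = minn (N ord0 w) (n - #|busy w|).
Proof.
rewrite /served /greedy unlift_none sum_onth_neq_None -cardE.
by rewrite [#|~: _|]cardsCs finset.setCK card_ord.
Qed.

Lemma load_greedy i w : (load greedy i w <= 1)%N.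
Proof.
rewrite /load big_ord_recl.
have -> : (\sum_(j < n) \sum_(k < N (own j) w)
    (greedy (own j) k w == Some i) = (i \in busy w))%N.
  rewrite (bigD1 i)//= [X in (_ + X)%N]big1 ?addn0 => [|j ji].
    rewrite inE /greedy liftK; case: (N (own i) w) => [|m].
      by rewrite big_ord0.
    by rewrite big_ord_recl/= eqxx big1.
  rewrite big1// => k _; rewrite /greedy liftK; case: ifP => // _.
  by rewrite (inj_eq Some_inj) (negbTE ji).
rewrite /greedy unlift_none.
apply: leq_trans (leq_add (sum_onth_eq _ _ _) (leqnn _)) _.
by rewrite count_uniq_mem ?enum_uniq// mem_enum inE; case: (i \in _).
Qed.

Lemma greedy_clairvoyant : clairvoyant greedy.
Proof.
split; last by move=> w i; exact: load_greedy.
- move=> j k o; rewrite /greedy; case: unliftP => [i _|_].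
    case: (pselect ((if k == 0%N then Some i else None) = o)) => ko.
      rewrite (_ : [set w | _] = [set w | (k < N j w)%N]); last first.
        by apply/seteqP; split => w //= [].
      exact: (@measurable_nat_pred _ _ _ [set m | (k < m)%N] (mN j)).
    rewrite (_ : [set w | _] = set0) //.
    by apply/seteqP; split => w //= [].
  (* A decision for type 0 depends on the outcome only through the random set [busy w], so the event
     is split according to its finitely many values [B]. *)
  rewrite (_ : [set w | _] = \bigcup_(B in [set B | onth (enum (~: B)) k = o])
    ([set w | (k < N j w)%N] `&` \bigcap_i
      [set w | (0 < N (own i) w)%N = (i \in B)])); last first.
    apply/seteqP; split => w /=.
      move=> [kN ko]; exists (busy w) => //; split => // i _ /=.
      by rewrite inE.
    move=> [B /= Bo [kN Bw]]; split => //; rewrite -Bo; congr (onth (enum (~: _)) k).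
    by apply/finset.setP => i; rewrite inE Bw.
  apply: fin_bigcup_measurable; first exact: finite_finset.
  move=> B _; apply: measurableI.
    exact: (@measurable_nat_pred _ _ _ [set m | (k < m)%N] (mN j)).
  apply: fin_bigcap_measurable; first exact: finite_finset.
  move=> i _.
  exact: (@measurable_nat_pred _ _ _ [set m | (0 < m)%N = (i \in B)] (mN _)).
- move=> w j k i _; rewrite /greedy /=; case: unliftP => [i' ->|->].
    by case: ifP => // _ [->]; rewrite eqxx.
  by rewrite orbT.
Qed.

End greedy.

(** * Fairness of the greedy algorithm *)

Section probability.
Variables (R : realType) (d : measure_display) (T : measurableType d).
Variable P : probability T R.

Lemma integral_nat_of_bool (b : T -> bool) : measurable [set w | b w] ->
  (\int[P]_w (b w)%:R%:E = P [set w | b w])%E.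
Proof.
move=> mb; rewrite -[in RHS](setIT [set w | b w]) -integral_indic//.
apply: eq_integral => w _; rewrite indicE; congr (EFin _).
by case: (boolP (b w)) => bw; [rewrite mem_set|rewrite memNset//; exact/negP].
Qed.

Lemma poisson_gt0_probability (Z : T -> nat) (l : R) :
  measurable_fun setT Z -> 0 < l ->
  P [set w | Z w = 0%N] = (poisson_pmf l 0)%:E ->
  P [set w | (0 < Z w)%N] = (1 - expR (- l))%:E.
Proof.
move=> mZ l0 law; rewrite (_ : [set w | (0 < Z w)%N] = ~` [set w | Z w = 0%N]).
  rewrite probability_setC; last exact: measurable_nat_eq.
  by rewrite [X in (_ - X)%E]law /poisson_pmf l0 expr0 fact0 invr1 !mul1r.
by apply/seteqP; split => w /=; rewrite lt0n => /eqP.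
Qed.

End probability.

Section greedy_fairness.
Variables (R : realType) (n : nat) (hn : (2 <= n)%N).
Variable S : setting (hard_instance R hn).
Local Notation N j := (@arrivals _ _ S j 1).
Local Notation own := (lift ord0).
Local Open Scope ereal_scope.

Let mN j : measurable_fun setT (N j).
Proof. by apply: measurable_arrivals; rewrite ler01 lexx. Qed.

Lemma arrivals_law j m :
  Pr S [set w | N j w = m] = (poisson_pmf (hard_rate R j) m)%:E.
Proof.
have := poisson_law (arrivals_poisson S j) m
  (lexx 0%R) ltr01 (lexx _).
rewrite subr0 mulr1 => <-; congr (Pr S _).
by apply/seteqP; split => w /=;
  rewrite (poisson_start (arrivals_poisson S j)) subn0.
Qed.

(** An own type is served whenever it arrives at all. Type 0 loses at most the busy agents, whose
    expected number is at most 1, and the excess of its arrivals over the mean, which is controlled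
    by the variance. *)
Lemma greedy_fairness (e : R) : (0 < e)%R ->
  (2 / e + 1 / e ^+ 2 <= n%:R - 1)%R ->
  (1 - e)%:E <= fairness (@greedy R n hn S).
Proof.
move=> e0 en.
have n0 : (0 < n%:R :> R)%R by rewrite ltr0n (leq_trans _ hn).
have n1 : (0 < n%:R - 1 :> R)%R := hard_rate_gt0 R hn ord0.
rewrite /fairness; apply: le_bigmin => [|j _]; first exact: leey.
rewrite inver gt_eqF; last exact: (hard_rate_gt0 R hn j).
rewrite lee_pdivlMr; last exact: (hard_rate_gt0 R hn j).
rewrite unlock -EFinM /=.
case: (unliftP ord0 j) => [i ->|->].
  under eq_integral do rewrite served_greedy_own.
  rewrite integral_nat_of_bool; last first.
    exact: (@measurable_nat_pred _ _ _ [set m | (0 < m)%N] (mN _)).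
  rewrite (@poisson_gt0_probability _ _ _ _ _ (hard_rate R (own i)))//; last 2 first.
  - exact: hard_rate_gt0.
  - exact: arrivals_law.
  rewrite lee_fin /hard_rate /=.
  set x : R := (n%:R^-1)%R.
  have x0 : (0 < x)%R by rewrite invr_gt0.
  have xe : (x <= e)%R.
    rewrite -(@ler_pM2l _ n%:R)// divff ?gt_eqF//.
    have : (2 / e <= n%:R)%R.
      have : (0 <= 1 / e ^+ 2)%R by rewrite divr_ge0// sqr_ge0.
      lra.
    by rewrite ler_pdivrMr//; lra.
  (* The chain is 1 - exp(-x) >= x / (1 + x) >= (1 - e) x, the last inequality because x <= e. *)
  have h := expR_ge1Dx x; rewrite expRN.
  have h1 : ((expR x)^-1 <= (1 + x)^-1)%R.
    by rewrite lef_pV2 ?posrE ?expR_gt0//; lra.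
  apply: (@le_trans _ _ (1 - (1 + x)^-1)%R); last by rewrite lerD2l lerN2.
  rewrite (_ : (1 - (1 + x)^-1 = x / (1 + x))%R); last first.
    by field; rewrite gt_eqF//; lra.
  rewrite ler_pdivlMr; last lra.
  by nra.
set l : R := hard_rate R ord0.
have lE : (l = n%:R - 1)%R by [].
have l0 : (0 < l)%R by rewrite lE.
(* With this [a] the expected loss 1 + l / (4 a) + a equals 1 + 1 / (2 e) + e l / 2. It is at most e
   l exactly when 2 / e + 1 / e^2 <= l, which is the hypothesis on [n]. *)
pose a : R := (e * l / 2)%R.
have a0 : (0 < a)%R by rewrite divr_gt0// mulr_gt0.
pose V w := ((served (@greedy R n hn S) ord0 w)%:R%:E : \bar R).
pose M w := (\sum_(i < n) (N (own i) w)%:R%:E : \bar R).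
pose Q w := (((N ord0 w)%:R - l) ^+ 2)%:E.
have mV : measurable_fun setT V.
  apply: measurable_natr; apply: measurable_served.
  exact: greedy_clairvoyant.
have mM : measurable_fun setT M.
  by apply: emeasurable_sum => i; apply: measurable_natr.
have mQ : measurable_fun setT Q by apply: (measurable_natr (fun m => (m%:R - l) ^+ 2)%R).
have V0 w : 0 <= V w by rewrite lee_fin.
have M0 w : 0 <= M w by apply: sume_ge0 => i _; rewrite lee_fin.
have Q0 w : 0 <= Q w by rewrite lee_fin sqr_ge0.
(* If the supply n - #|busy w| is the binding term, then V + M >= n > l, and the excess x = N - l
   satisfies x <= x^2 / (4 a) + a because (x - 2 a)^2 >= 0. Otherwise V = N already. *)
have key w : (N ord0 w)%:R%:E <= V w + M w + ((4 * a)^-1%:E * Q w + a%:E).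
  rewrite /V /M /Q sumEFin -EFinM -!EFinD lee_fin served_greedy0 -natr_sum.
  have bM : (#|busy w| <= \sum_(i < n) N (own i) w)%N.
    rewrite -sum1_card big_mkcond/=; apply: leq_sum => i _.
    by rewrite inE; case: ifP.
  have amgm : ((N ord0 w)%:R - l <= (4 * a)^-1 * ((N ord0 w)%:R - l) ^+ 2 + a)%R.
    rewrite -(@ler_pM2l _ (4 * a)); last by rewrite mulr_gt0.
    rewrite [leRHS]mulrDr mulVKf ?gt_eqF ?mulr_gt0//.
    have := sqr_ge0 ((N ord0 w)%:R - l - 2 * a)%R.
    rewrite !expr2; lra.
  have q0 : (0 <= (4 * a)^-1 * ((N ord0 w)%:R - l) ^+ 2)%R.
    by rewrite mulr_ge0 ?sqr_ge0// invr_ge0 mulr_ge0// ltW.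
  have := leq_trans (leqnn _) bM; rewrite -(ler_nat R) => bMR.
  have : (0 <= #|busy w|%:R :> R)%R by [].
  have bn : (#|busy w| <= n)%N by rewrite -[X in (_ <= X)%N]card_ord max_card.
  by case: leqP => _; rewrite ?natrB//; lra.
have : \int[Pr S]_w (N ord0 w)%:R%:E <=
    \int[Pr S]_w (V w + M w + ((4 * a)^-1%:E * Q w + a%:E)).
  apply: ge0_le_integral => //.
  - exact: measurable_natr.
  - apply: emeasurable_funD; first exact: emeasurable_funD.
    apply: emeasurable_funD => //; exact: measurable_funeM.
rewrite (@integral_poisson _ _ _ _ _ _ l (fun m => m%:R)%R)//; last first.
  exact: arrivals_law.
rewrite poisson_mean// ge0_integralD//; last 4 first.
- by move=> w _; rewrite adde_ge0.
- exact: emeasurable_funD.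
- by move=> w _; rewrite adde_ge0 ?mule_ge0// lee_fin ?invr_ge0 ?mulr_ge0// ltW.
- by apply: emeasurable_funD => //; exact: measurable_funeM.
rewrite ge0_integralD// ge0_integralD//; last 3 first.
- by move=> w _; rewrite mule_ge0// lee_fin invr_ge0 mulr_ge0// ltW.
- exact: measurable_funeM.
- by move=> w _; rewrite lee_fin ltW.
rewrite ge0_integralZl_EFin//; last by rewrite invr_ge0 mulr_ge0// ltW.
rewrite (@integral_poisson _ _ _ _ _ _ l (fun m => (m%:R - l) ^+ 2)%R)//; last 2 first.
- by move=> m; rewrite sqr_ge0.
- exact: arrivals_law.
rewrite poisson_variance// integral_cst// [X in a%:E * X]probability_setT mule1.
have -> : \int[Pr S]_w M w = 1.
  rewrite ge0_integral_sum//; last by move=> i; exact: measurable_natr.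
  under eq_bigr => i _.
    rewrite (@integral_poisson _ _ _ _ _ _ (n%:R^-1) (fun m => m%:R)%R)//.
      rewrite poisson_mean; first over.
    by rewrite invr_gt0.
    exact: arrivals_law.
  rewrite sumEFin sumr_const card_ord; congr EFin.
  by rewrite -[LHS]mulr_natr mulVf// gt_eqF.
set E := integral _ _ _ => h.
have : (l - 1 - ((4 * a)^-1 * l + a))%:E <= E.
  rewrite EFinB leeBlDr// EFinB leeBlDr//.
  by rewrite -EFinM -EFinD addeAC in h.
apply: le_trans; rewrite lee_fin.
rewrite (_ : ((4 * a)^-1 * l = 1 / (2 * e))%R); last first.
  by rewrite /a; field; rewrite !gt_eqF.
have : (2 + 2 * (1 / (2 * e)) <= e * l)%R.
  rewrite (_ : 2 + 2 * (1 / (2 * e)) = e * (2 / e + 1 / e ^+ 2))%R ?ler_pM2l//.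
  by field; rewrite gt_eqF.
rewrite /a; lra.
Qed.

End greedy_fairness.

(* With h = 1/K, h max(0, x) dominates the increment of max(0, .)^2 / 2 between
   x - h and x, and these increments telescope. *)
Lemma riemann_sum_pos_part (R : realType) (v : R) (K : nat) :
  0 <= v <= 1 -> (0 < K)%N ->
  v ^+ 2 / 2 - v / K%:R <=
  \sum_(i < K) Num.max 0 (v - 1 + i%:R / K%:R) / K%:R.
Proof.
move=> /andP[v0 v1] K0; have h0 : 0 < K%:R :> R by rewrite ltr0n.
pose phi (x : R) := Num.max 0 x ^+ 2 / 2.
pose h : R := K%:R^-1.
have h_gt0 : 0 < h by rewrite invr_gt0.
pose f i := phi (v - 1 + i%:R * h - h).
(* Here f(0) = 0 because v <= 1, and f(K) = phi(v - h) >= v^2 / 2 - v h. *)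
apply: (@le_trans _ _ (f K - f 0%N)).
  rewrite /f /phi mulfV ?gt_eqF// mul0r [X in _ - X ^+ 2 / _]max_l; last lra.
  rewrite -/h expr0n/= mul0r subr0 subrK.
  by case: (leP (v - h) 0) => ?; nra.
rewrite -(telescope_sumr f (leq0n K)) big_mkord; apply: ler_sum => i _.
rewrite /f -/h -natr1; set x := v - 1 + i%:R * h.
rewrite (_ : v - 1 + (i%:R + 1) * h - h = x); last by rewrite /x; ring.
rewrite /phi; case: (leP x 0) => ?; case: (leP (x - h) 0) => ?; nra.
Qed.

(** * Upper bound for online algorithms on a time grid *)

Definition grid (R : realType) (K i : nat) : R := i%:R / K%:R.

Section online.
Variables (R : realType) (n : nat) (hn : (2 <= n)%N).
Variables (S : setting (hard_instance R hn)) (D : decisions S).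
Hypothesis onD : online D.
Local Notation N := (@arrivals _ _ S).
Local Notation own := (lift ord0).
Let clD : clairvoyant D. Proof. by case: onD. Qed.

Let n_gt0 : 0 < n%:R :> R. Proof. by rewrite ltr0n (leq_trans _ hn). Qed.

Let mN j s : 0 <= s <= 1 -> measurable_fun setT (N j s).
Proof. exact: measurable_arrivals. Qed.

Definition used (i : 'I_n) (s : R) (w : Omega S) : bool :=
  [exists k : 'I_(N ord0 s w), D ord0 k w == Some i].

(** This is where the algorithm being online, and not merely clairvoyant, enters the bound. *)
Lemma used_information i s : 0 <= s <= 1 ->
  <<s information_gen S s >> [set w | used i s w].
Proof.
move=> s01; rewrite (_ : [set w | _] =
    \bigcup_k [set w | (k < N ord0 s w)%N /\ D ord0 k w = Some i]).
  apply: (@bigcupT_measurable _ (g_sigma_algebraType (information_gen S s))).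
  by move=> k; exact: (proj2 onD).
apply/seteqP; split => w /=.
  by move=> /existsP[k /eqP Dk]; exists k.
by move=> [k _ [kN Dk]]; apply/existsP; exists (Ordinal kN); apply/eqP.
Qed.

(** Eligibility leaves a single agent to an own type, so each of its served arrivals burdens that
    agent, on top of the service given to type 0. *)
Lemma load_ge_own i w : (served D (own i) w +
  \sum_(k < N ord0 1 w) (D ord0 k w == Some i) <= load D i w)%N.
Proof.
rewrite /load big_ord_recl addnC leq_add2l (bigD1 i)//= (leq_trans _ (leq_addr _ _))//.
apply: leq_sum => k _; case Dk : (D (own i) k w) => [i'|]//.
have := decisions_eligible clD (ltn_ord k) Dk.
by rewrite /= eqSS orbF eq_sym => /eqP/val_inj ->; rewrite eqxx.
Qed.

Lemma used_mono i s w : 0 <= s <= 1 -> used i s w ->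
  (0 < \sum_(k < N ord0 1 w) (D ord0 k w == Some i))%N.
Proof.
move=> /andP[s0 s1] /existsP[k Dk].
have kN : (k < N ord0 1 w)%N.
  rewrite (leq_trans (ltn_ord k))//.
  exact: (poisson_mono (arrivals_poisson S ord0)).
by rewrite (bigD1 (Ordinal kN))//= Dk.
Qed.

Section grid.
Variable K : nat.
Hypothesis K_gt0 : (0 < K)%N.
Local Notation g := (grid R K).

Let KR : 0 < K%:R :> R. Proof. by rewrite ltr0n. Qed.
Let g_ge0 i : 0 <= g i. Proof. by rewrite divr_ge0. Qed.
Let g_le1 i : (i <= K)%N -> g i <= 1.
Proof. by move=> iK; rewrite /grid ler_pdivrMr// mul1r ler_nat. Qed.
Let g01 i : (i <= K)%N -> 0 <= g i <= 1.
Proof. by move=> iK; rewrite g_ge0 g_le1. Qed.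
Let gS i : g i.+1 - g i = K%:R^-1.
Proof. by rewrite /grid -natr1; field; rewrite gt_eqF. Qed.
Let g_lt i : g i < g i.+1.
Proof. by rewrite -subr_gt0 gS invr_gt0. Qed.

Definition late_arrival (t : 'I_n) (i : nat) (w : Omega S) : bool :=
  ~~ used t (g i) w && (0 < N (own t) (g i.+1) w - N (own t) (g i) w)%N.

(* If agent t serves its own type then it is never used by type 0, in particular
   not before the grid interval of the first arrival of type t. *)
Lemma served_own_le t w :
  (served D (own t) w <= \sum_(i < K) late_arrival t i w)%N.
Proof.
have l1 := decisions_capacity clD w t.
have := leq_trans (load_ge_own t w) l1 => {l1}/= l1.
have [->//|s_gt0] := posnP (served D (own t) w).
have unused i : (i <= K)%N -> ~~ used t (g i) w.
  move=> iK; apply/negP => /(used_mono (g01 iK)) u.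
  by have := leq_trans (leq_add s_gt0 u) l1.
have s1 : (served D (own t) w <= 1)%N := leq_trans (leq_addr _ _) l1.
apply: (leq_trans s1); rewrite lt0n; apply/negP => /eqP late0.
have stay i : (i <= K)%N -> N (own t) (g i) w = 0%N.
  elim: i => [_|i ih iK].
    by rewrite /grid mul0r; exact: (poisson_start (arrivals_poisson S (own t))).
  have /eqP := late0; rewrite sum_nat_eq0 => /forallP/(_ (Ordinal iK))/=.
  rewrite /late_arrival (unused _ (ltnW iK)) (ih (ltnW iK)) subn0 eqb0 -leqNgt.
  by rewrite leqn0 => /eqP.
have := stay K (leqnn _); rewrite /grid divff ?gt_eqF// => N0.
by move: s_gt0; rewrite /served N0 big_ord0.
Qed.

Let measurable_info s A : 0 <= s -> s < 1 ->
  <<s information_gen S s >> A -> measurable A.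
Proof.
move=> s0 s1 iA.
by have [] := @information_increment_indep R _ S ord0 s 1 0%N A s0 s1 (lexx _) iA.
Qed.

Lemma measurable_used t i : (i < K)%N -> measurable [set w | used t (g i) w].
Proof.
move=> iK; apply: measurable_info (used_information _ (g01 (ltnW iK))) => //.
by rewrite (lt_le_trans (g_lt i))// g_le1.
Qed.

Lemma late_arrival_probability t i : (i < K)%N ->
  measurable [set w | late_arrival t i w] /\
  (Pr S [set w | late_arrival t i w] <=
   ((1 - fine (Pr S [set w | used t (g i) w])) / (n%:R * K%:R))%:E)%E.
Proof.
move=> iK; have g0 := g_ge0 i; have gl := g_lt i; have g1 := g_le1 iK.
set U := [set w | used t (g i) w]; have mU := measurable_used t iK.
have iU : <<s information_gen S (g i) >> (~` U).
  apply: (@measurableC _ (g_sigma_algebraType (information_gen S (g i)))).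
  exact: (used_information _ (g01 (ltnW iK))).
set J := [set w | (N (own t) (g i.+1) w - N (own t) (g i) w)%N = 0%N].
have mJ : measurable J.
  apply: measurable_nat_eq; apply: measurable_fun_subn; apply: mN.
    exact: g01.
  by apply: g01; exact: ltnW.
have [_ indep] := @information_increment_indep R _ S (own t) _ _ 0%N _ g0 gl g1 iU.
(* Removing the event [J] of no arrival lets independence be applied to the single increment value
   0. *)
have -> : [set w | late_arrival t i w] = (~` U) `\` J.
  apply/seteqP; split => w /=; rewrite /late_arrival /U /J /= lt0n.
    by move=> /andP[/negP ? /eqP].
  by move=> [/negP ? /eqP ?]; apply/andP.
split; first by apply: measurableD => //; exact: measurableC.
have mUC := measurableC mU.
have -> : (Pr S (~` U `\` J) = Pr S (~` U) - Pr S (~` U `&` J))%E.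
  by rewrite measureD// ltey_eq fin_num_measure.
rewrite indep (poisson_law (arrivals_poisson S (own t)))// -/U.
rewrite probability_setC// -[Pr S U]fineK ?fin_num_measure//.
set p := fine _.
have p1 : p <= 1.
  by rewrite -lee_fin fineK ?fin_num_measure// probability_le1.
rewrite -EFinB /= lee_fin /poisson_pmf gS ifT; last first.
  by rewrite mulr_gt0 ?invr_gt0// rate_gt0.
rewrite expr0 fact0 invr1 !mul1r /= /hard_rate /=.
set x : R := _ / _; have := expR_ge1Dx (- x) => hx.
rewrite (_ : (n%:R * K%:R)^-1 = x); last by rewrite /x invfM.
by nra.
Qed.

Lemma served_own_expectation (t : 'I_n) :
  (\int[Pr S]_w (served D (own t) w)%:R%:E <=
   (\sum_(i < K) (1 - fine (Pr S [set w | used t (g i) w])) / (n%:R * K%:R))%:E)%E.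
Proof.
have mL (i : 'I_K) : measurable_fun setT (fun w => late_arrival t i w : nat).
  by apply: measurable_fun_nat_of_bool; have [] := late_arrival_probability t (ltn_ord i).
apply: (@le_trans _ _
    (\int[Pr S]_w (\sum_(i < K) (late_arrival t i w)%:R%:E))%E).
  apply: ge0_le_integral => //.
  - by apply: measurable_natr; exact: measurable_served.
  - by apply: emeasurable_sum => i; exact: (measurable_natr (fun m => m%:R) (mL i)).
  - by move=> w _; rewrite sumEFin lee_fin -natr_sum ler_nat served_own_le.
rewrite ge0_integral_sum//; last first.
  by move=> i; exact: (measurable_natr (fun m => m%:R) (mL i)).
rewrite -sumEFin; apply: lee_sum => i _.
have [mA leA] := late_arrival_probability t (ltn_ord i).
by rewrite integral_nat_of_bool.
Qed.

(** The arrivals of type 0 are split at time [s]. Those served before occupy distinct agents by the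
    unit capacities, and those after are bounded by their number. *)
Lemma served0_le s w : 0 <= s <= 1 ->
  (served D ord0 w <=
   \sum_(t < n) used t s w + (N ord0 1 w - N ord0 s w))%N.
Proof.
move=> s01; have /andP[s0 s1] := s01.
have Ns : (N ord0 s w <= N ord0 1 w)%N.
  exact: (poisson_mono (arrivals_poisson S ord0)).
rewrite /served -(big_mkord xpredT (fun k => nat_of_bool (D ord0 k w != None))).
rewrite (big_cat_nat (leq0n _) Ns)/=; apply: leq_add; last first.
  rewrite -[leqRHS]muln1 -sum_nat_const_nat.
  by apply: leq_sum => k _; case: (_ != _).
rewrite big_mkord (eq_bigr (fun k : 'I_(N ord0 s w) =>
    \sum_(t < n) (D ord0 k w == Some t)))%N; last first.
  move=> k _; case Dk : (D ord0 k w) => [t|]/=.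
    rewrite (bigD1 t)//= eqxx big1// => t' /negbTE tt'.
    by rewrite (inj_eq Some_inj) eq_sym tt'.
  by rewrite big1.
rewrite exchange_big/=; apply: leq_sum => t _.
case: (boolP (used t s w)) => [u|/existsPn unused]; last first.
  by rewrite big1// => k _; rewrite (negbTE (unused k)).
apply: leq_trans (decisions_capacity clD w t).
apply: leq_trans (load_ge_own t w); apply: leq_trans (leq_addl _ _).
rewrite -(big_mkord xpredT (fun k => nat_of_bool (D ord0 k w == Some t))).
rewrite -[leqRHS](big_mkord xpredT (fun k => nat_of_bool (D ord0 k w == Some t))).
by rewrite [leqRHS](big_cat_nat (leq0n _) Ns)/= leq_addr.
Qed.

Lemma served0_expectation (i : nat) : (i < K)%N ->
  (\int[Pr S]_w (served D ord0 w)%:R%:E <=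
   (\sum_(t < n) fine (Pr S [set w | used t (g i) w]) +
    (n%:R - 1) * (1 - g i))%:E)%E.
Proof.
move=> iK; have gi1 : g i < 1 by rewrite (lt_le_trans (g_lt i))// g_le1.
have s01 := g01 (ltnW iK).
have mU (t : 'I_n) : measurable_fun setT (fun w => used t (g i) w : nat).
  by apply: measurable_fun_nat_of_bool; exact: measurable_used.
have mI : measurable_fun setT (fun w => N ord0 1 w - N ord0 (g i) w)%N.
  by apply: measurable_fun_subn; apply: mN => //; rewrite ler01 lexx.
have mUE (t : 'I_n) := measurable_natr (fun m => m%:R : R) (mU t).
have mIE := measurable_natr (fun m => m%:R : R) mI.
apply: (@le_trans _ _ (\int[Pr S]_w (\sum_(t < n) (used t (g i) w)%:R%:E +
    (N ord0 1 w - N ord0 (g i) w)%N%:R%:E))%E).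
  apply: ge0_le_integral => //.
  - by apply: measurable_natr; exact: measurable_served.
  - by apply: emeasurable_funD => //; exact: emeasurable_sum.
  - move=> w _; rewrite sumEFin -EFinD lee_fin -natr_sum -natrD ler_nat.
    exact: served0_le.
rewrite ge0_integralD//; last 2 first.
- by move=> w _; apply: sume_ge0 => t _; rewrite lee_fin.
- exact: emeasurable_sum.
rewrite ge0_integral_sum//.
rewrite (@integral_poisson _ _ _ _ _ mI ((n%:R - 1) * (1 - g i))
  (fun m => m%:R))//; last first.
  by move=> m; exact: (poisson_law (arrivals_poisson S ord0) m (g_ge0 i) gi1 (lexx _)).
rewrite poisson_mean ?mulr_gt0 ?subr_gt0 ?ltr1n// EFinD -sumEFin.
apply: leeD => //; apply: lee_sum => t _.
rewrite integral_nat_of_bool ?fineK ?fin_num_measure//; exact: measurable_used.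
Qed.

Lemma online_fairness_bound (v : R) : 0 <= v <= 1 ->
  (v%:E <= fairness D)%E ->
  (v + 1) ^+ 2 <= 3 + 2 / K%:R + 2 / n%:R.
Proof.
move=> v01 vD.
have vj (j : 'I_n.+1) : ((v * hard_rate R j)%:E <=
    \int[Pr S]_w (served D j w)%:R%:E)%E.
  have rj := hard_rate_gt0 R hn j.
  have := le_trans vD (bigmin_le _ j _).
  by rewrite inver gt_eqF// lee_pdivlMr// unlock -EFinM.
pose p t i := fine (Pr S [set w | used t (g i) w]).
pose F i := \sum_(t < n) p t i.
(* Summing the bounds over the [n] own types, each of rate 1/n, leaves exactly [v] on the left. *)
have H1 : v <= \sum_(i < K) (1 - F i / n%:R) / K%:R.
  have : \sum_(t < n) v * n%:R^-1 <=
      \sum_(t < n) \sum_(i < K) (1 - p t i) / (n%:R * K%:R).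
    apply: ler_sum => t _; rewrite -lee_fin.
    exact: le_trans (vj (own t)) (served_own_expectation t).
  rewrite sumr_const card_ord -mulrnAr -(mulr_natr _ n) mulVf ?gt_eqF// mulr1.
  rewrite exchange_big/=; congr (_ <= _); apply: eq_bigr => i _.
  rewrite -mulr_suml sumrB sumr_const card_ord -/(F i) -mulr_natr mul1r.
  by field; rewrite !gt_eqF.
(* The bound for type 0 reads F(i) >= (n - 1) (v - 1 + i/K). The term 1/n pays for replacing n - 1
   by n, as v - 1 + i/K <= 1. *)
have H2 i : (i < K)%N -> Num.max 0 (v - 1 + i%:R / K%:R) <= F i / n%:R + n%:R^-1.
  move=> iK; have F0 : 0 <= F i.
    by apply: sumr_ge0 => t _; apply: fine_ge0.
  have ni : 0 < n%:R^-1 :> R by rewrite invr_gt0.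
  have [] := leP (v - 1 + i%:R / K%:R) 0 => [_|x0].
    by rewrite addr_ge0 ?mulr_ge0// ltW.
  have := le_trans (vj ord0) (served0_expectation iK).
  rewrite lee_fin /hard_rate eqxx -/(F i) => h.
  rewrite -(ler_pM2r n_gt0) [leRHS]mulrDl mulVf ?gt_eqF// divfK ?gt_eqF//.
  move: x0 h (g_le1 (ltnW iK)); rewrite -[i%:R / K%:R]/(g i).
  by move: v01 => /andP[]; nra.
have := riemann_sum_pos_part v01 K_gt0.
have : \sum_(i < K) Num.max 0 (v - 1 + i%:R / K%:R) / K%:R <=
    \sum_(i < K) (F i / n%:R + n%:R^-1) / K%:R.
  by apply: ler_sum => i _; rewrite ler_pM2r ?invr_gt0//; exact: H2.
(* The unknown usage F(i) cancels between the two bounds, leaving v + v^2 / 2 - v / K <= 1 + 1 / n.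
   Doubling and completing the square gives the claim. *)
have : \sum_(i < K) (F i / n%:R + n%:R^-1) / K%:R +
    \sum_(i < K) (1 - F i / n%:R) / K%:R = 1 + n%:R^-1.
  rewrite -big_split/= (eq_bigr (fun=> (1 + n%:R^-1) / K%:R)).
    by rewrite sumr_const card_ord -[LHS]mulr_natr divfK ?gt_eqF.
  by move=> i _; rewrite -mulrDl; congr (_ / _); ring.
have : v / K%:R <= 1 / K%:R.
  by rewrite ler_pM2r ?invr_gt0//; case/andP: v01.
move: H1; rewrite !expr2; lra.
Qed.

End grid.
End online.

(** * Choice of constants and conclusion *)

Theorem theorem3 (R : realType) :
  ~ exists c : R, Num.sqrt 3 - 1 < c /\
      forall (n : nat) (hn : (2 <= n)%N),
        exists (S : setting (hard_instance R hn)) (D : decisions S),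
          online D /\
          (c%:E * clairvoyant_opt (hard_instance R hn) <= fairness D)%E.
Proof.
move=> [c [c_gt onl]].
have s3 : Num.sqrt 3 ^+ 2 = 3 :> R by rewrite sqr_sqrtr.
have s0 : 0 <= Num.sqrt 3 :> R by rewrite sqrtr_ge0.
have s1 : 1 < Num.sqrt 3 :> R by nra.
have s2 : Num.sqrt 3 < 2 :> R by nra.
(* The midpoint of sqrt 3 - 1 and [c] is capped at 1, since the bound for online algorithms is
   stated for values in [0, 1]. *)
have [v [v_gt vc v1]] : exists v : R, [/\ Num.sqrt 3 - 1 < v, v < c & v <= 1].
  have [h|h] := leP 1 ((Num.sqrt 3 - 1 + c) / 2); first by exists 1; split; lra.
  by exists ((Num.sqrt 3 - 1 + c) / 2); split; lra.
have c0 : 0 < c by lra.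
(* The clairvoyant may lose this much: c (1 - e) = v. *)
pose e := 1 - v / c.
have e0 : 0 < e by rewrite subr_gt0 ltr_pdivrMr ?mul1r.
pose dl := (v + 1) ^+ 2 - 3.
have dl0 : 0 < dl by rewrite /dl -s3; nra.
(* The first two terms serve the greedy bound, the 2 gives n >= 2 and covers the shift to n - 1, and
   the last term makes 4 / n < dl. *)
pose M := 2 / e + 1 / e ^+ 2 + 2 + 4 / dl.
have [n nM] : exists n, M < n%:R by exists (Num.truncn M).+1; exact: truncnS_gt.
have [t1 t2 t3] : [/\ 0 <= 2 / e, 0 <= 1 / e ^+ 2 & 0 < 4 / dl].
  by rewrite !divr_ge0 ?sqr_ge0 ?divr_gt0// ltW.
have hn : (2 <= n)%N by rewrite -(ler_nat R); rewrite /M in nM; lra.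
have [S [D [onD optD]]] := onl n hn.
have vD : (v%:E <= fairness D)%E.
  apply: le_trans optD; apply: (@le_trans _ _ (c%:E * (1 - e)%:E)%E).
    by rewrite -EFinM lee_fin /e subKr mulrC divfK// gt_eqF.
  rewrite lee_pmul2l ?lte_fin//.
  apply: (@le_trans _ _ (fairness (@greedy R n hn S))).
    by apply: greedy_fairness => //; rewrite /M in nM; lra.
  apply: ereal_sup_ubound; exists S, (@greedy R n hn S).
  by split => //; exact: greedy_clairvoyant.
have n0 : (0 < n)%N by rewrite (leq_trans _ hn).
have nR : 0 < n%:R :> R by rewrite ltr0n.
have v01 : 0 <= v <= 1 by rewrite v1 andbT; lra.
(* The grid is taken with K = n intervals, so the total error is 4 / n. *)
have := online_fairness_bound onD n0 v01 vD.
have : 4 / n%:R < dl.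
  rewrite ltr_pdivrMr// mulrC -ltr_pdivrMr//; rewrite /M in nM; lra.
rewrite /dl; lra.
Qed.
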